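(* Let an $n\times n$ matrix $Q$ be a square root of the $n\times n$ matrix $A$: $Q^2=A$. Let $f_1,f_2$ be $n\times h$ matrices and, for $x\in\mathcal I_1$, $t\in\mathcal I_2$, put $$\Lambda_1(x,t):=-\mathrm{i}Q\big(\mathrm{e}^{\mathrm{i}(xQ+4tQ^3)}f_1-\mathrm{e}^{-\mathrm{i}(xQ+4tQ^3)}f_2\big),$$ $$\Lambda_2(x,t):=\mathrm{e}^{\mathrm{i}(xQ+4tQ^3)}f_1+\mathrm{e}^{-\mathrm{i}(xQ+4tQ^3)}f_2 .$$ Then: (1) $\Lambda_1,\Lambda_2$ satisfy $$\frac{\partial}{\partial x}\Lambda_1=A\Lambda_2,\quad \frac{\partial}{\partial x}\Lambda_2=-\Lambda_1,\quad \frac{\partial}{\partial t}\Lambda_1=4A^2\Lambda_2,\quad \frac{\partial}{\partial t}\Lambda_2=-4A\Lambda_1 .$$ (2) If $-\mathrm{i}Q(f_1-f_2)=\vartheta_1$ and $f_1+f_2=\vartheta_2$, where $\Pi(0,0)=\begin{bmatrix}\vartheta_1&\vartheta_2\end{bmatrix}$ is the matrix from the triple $\{A,S(0,0),\Pi(0,0)\}$, then $\begin{bmatrix}\Lambda_1(0,0)&\Lambda_2(0,0)\end{bmatrix}=\Pi(0,0)$. (3) Moreover, the matrix function $S(x,t)$, with given value $S(0,0)$ at $(0,0)$, may be explicitly calculated (for each $Q$ and $\Pi(0,0)$) using the relations $$\frac{\partial}{\partial x}S=\Lambda_2\Lambda_2^*,\qquad \frac{\partial}{\partial t}S=4\big(A\Lambda_2\Lambda_2^*+\Lambda_2\Lambda_2^*A^*+\Lambda_1\Lambda_1^*\big),$$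 which determine it.
   Context: $n,h$ are positive integers and $m=2h$. All matrices have complex entries; $M^*$ is the conjugate transpose, $I_h$ the $h\times h$ identity matrix, and $\mathrm i$ the imaginary unit. $\mathcal I_1,\mathcal I_2\subset\mathbb R$ are intervals containing $0$. A triple $\{A,S(0,0),\Pi(0,0)\}$ consists of $n\times n$ matrices $A$ and $S(0,0)$ and an $n\times m$ matrix $\Pi(0,0)=\begin{bmatrix}\vartheta_1&\vartheta_2\end{bmatrix}$ with $n\times h$ blocks $\vartheta_1,\vartheta_2$, such that $AS(0,0)-S(0,0)A^*=\Pi(0,0)j\Pi(0,0)^*$ and $S(0,0)=S(0,0)^*$, where $j=\begin{bmatrix}0&I_h\\-I_h&0\end{bmatrix}$. *)

(* Defs.v *)
(* The complex numbers are R[i], for an arbitrary R : realType. *)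
From HB Require Import structures.
From mathcomp Require Import all_boot all_order all_algebra.
From mathcomp Require Import complex.
From mathcomp Require Import all_classical all_reals all_analysis.

Set Implicit Arguments.
Unset Strict Implicit.
Unset Printing Implicit Defensive.

Import Order.TTheory GRing.Theory Num.Theory.
Import numFieldNormedType.Exports.

Local Open Scope classical_set_scope.
Local Open Scope ring_scope.
Local Open Scope sesquilinear_scope.

(* The usual norm topology of R[i]; matrices over R[i] then carry the
   entrywise (product) topology. *)
HB.instance Definition _ (R : rcfType) :=
  NormedModule.copy R[i] (R[i] : numFieldType)^o.

Definition expmx (R : realType) (n : nat) (M : 'M[R[i]]_n) : 'M[R[i]]_n :=
  lim (series (fun k => (k`!%:R)^-1 *: M ^+ k) @ \oo).

(* [is_deriv_in I F x D]: F, as a function on the interval I, has derivative D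
   at x.  Points of I only are used, so that the derivative is one-sided at an
   endpoint of I that belongs to I. *)
Definition is_deriv_in (R : realType) (p q : nat) (I : interval R)
    (F : R -> 'M[R[i]]_(p, q)) (x : R) (D : 'M[R[i]]_(p, q)) : Prop :=
  ((y - x)^-1)%:C%C *: (F y - F x) @[y --> within [set` I] x^'] --> D.

(* Oriented integral from a to b (b < a is allowed). *)
Definition oint (R : realType) (a b : R) (f : R -> R) : R :=
  if a <= b then \int[lebesgue_measure]_(s in `[a, b]) f s
  else - \int[lebesgue_measure]_(s in `[b, a]) f s.

Definition mx_oint (R : realType) (p q : nat) (a b : R)
    (F : R -> 'M[R[i]]_(p, q)) : 'M[R[i]]_(p, q) :=
  \matrix_(i, j) (oint a b (fun s => complex.Re (F s i j)) +i*
                  oint a b (fun s => complex.Im (F s i j)))%C.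

Definition jmx (R : realType) (h : nat) : 'M[R[i]]_(h + h) :=
  block_mx 0 1%:M (- 1%:M) 0.

Definition is_triple (R : realType) (n h : nat) (A S0 : 'M[R[i]]_n)
    (Pi0 : 'M[R[i]]_(n, h + h)) : Prop :=
  A *m S0 - S0 *m A^t* = Pi0 *m jmx R h *m Pi0^t* /\ S0 = S0^t*.

Section Lambda.
Variables (R : realType) (n h : nat) (Q : 'M[R[i]]_n) (f1 f2 : 'M[R[i]]_(n, h)).

Definition phase (x t : R) : 'M[R[i]]_n :=
  'i%C *: (x%:C%C *: Q + (4 * t)%:C%C *: Q ^+ 3).

Definition Lambda1 (x t : R) : 'M[R[i]]_(n, h) :=
  (- 'i%C *: Q) *m (expmx (phase x t) *m f1 - expmx (- phase x t) *m f2).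

Definition Lambda2 (x t : R) : 'M[R[i]]_(n, h) :=
  expmx (phase x t) *m f1 + expmx (- phase x t) *m f2.

Definition rhs_Sx (x t : R) : 'M[R[i]]_n := Lambda2 x t *m (Lambda2 x t)^t*.

Definition rhs_St (A : 'M[R[i]]_n) (x t : R) : 'M[R[i]]_n :=
  4 *: (A *m Lambda2 x t *m (Lambda2 x t)^t*
        + Lambda2 x t *m (Lambda2 x t)^t* *m A^t*
        + Lambda1 x t *m (Lambda1 x t)^t*).

Definition solves_S (I1 I2 : interval R) (A S0 : 'M[R[i]]_n)
    (S : R -> R -> 'M[R[i]]_n) : Prop :=
  S 0 0 = S0 /\
  forall x t, x \in I1 -> t \in I2 ->
    is_deriv_in I1 (fun y => S y t) x (rhs_Sx x t) /\
    is_deriv_in I2 (fun s => S x s) t (rhs_St A x t).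

End Lambda.

(* Main.v *)
Require Import Defs.
From HB Require Import structures.
From mathcomp Require Import all_boot all_order all_algebra.
From mathcomp Require Import complex.
From mathcomp Require Import all_classical all_reals all_analysis.
From mathcomp Require Import ring.
Set Implicit Arguments.
Unset Strict Implicit.
Unset Printing Implicit Defensive.
Import Order.TTheory GRing.Theory Num.Theory.
Import numFieldNormedType.Exports.
Local Open Scope classical_set_scope.
Local Open Scope ring_scope.
Local Open Scope sesquilinear_scope.

(** For a square matrix K put flow K x t = exp (x K - 4 t K^3). With K = i Q the
    two exponentials of the statement are flow K and flow (- K), because
    (i Q)^3 = - i Q^3. Stacking them into the flow of the block-diagonal matrix
    B = diag (K, - K) gives
      Lambda2 = P flow(B) Y,   Lambda1 = - P B flow(B) Y,
    with P = (1 1), Y the column of f1 and f2, and A P = - P B^2. The four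
    differential equations follow by differentiating the flow, whose generators
    B and -4 B^3 commute ([pair1_derive_x] and its companions).

    For S the point is the existence of a function having the two prescribed
    partial derivatives. Instead of differentiating under an integral sign,
    a closed form is given ([potential]). Put E = flow B and Z = Y Y*;
    consider the block triangular matrix W with diagonal blocks - B, B* and
    upper right block Z. If G is the upper right block of flow W, then E G
    vanishes at the origin and has derivatives E Z E* in x and -4 E (B^2 Z -
    B Z B* + Z B*^2) E* in t: the terms of the left diagonal block cancel
    against the derivative of E, the lower right block of flow W is flow B*
    = E*, and the middle factor is the upper right block of W^3. Since A P =
    - P B^2, the function S0 + P E G P* has exactly the two required
    derivatives ([pair_gram_derive_x], [pair_gram_derive_t]).

    Uniqueness is the mean value theorem, first along the axis t = 0 and then
    along each vertical line ([is_deriv_in_eq]). The integral formula is the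
    fundamental theorem of calculus along the same path ([mx_oint_FTC]).

    What remains is analysis of the exponential. The entries of exp (x M) are
    real power series in x, up to real and imaginary parts, with coefficients
    bounded by those of a scalar exponential; termwise differentiation gives the
    derivative ([expmx_derive]). The law exp (M + N) = exp M exp N for commuting
    M, N, which makes the derivative in each variable computable while the other
    is held fixed, comes from uniqueness for linear differential equations
    ([linear_ode_sol]). *)

(** * Convergence of complex numbers and complex matrices *)

Section EntrywiseConvergence.
Variable R : realType.

Lemma normc_le_ReIm (z : R[i]) :
  `|z| <= (`|complex.Re z| + `|complex.Im z|)%:C%C.
Proof.
rewrite [z in `|z|]complexE (le_trans (ler_normD _ _))// normrM complexiE.
by rewrite normCi mul1r rmorphD /= !normc_def /= !expr0n /= !addr0 !sqrtr_sqr.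
Qed.

Lemma normc_ge_Im (z : R[i]) : `|complex.Im z|%:C%C <= `|z|.
Proof.
suff -> : `|z| = `|complex.Im z -i* complex.Re z|%C.
  exact: (normc_ge_Re (complex.Im z -i* complex.Re z)%C).
by rewrite !normc_def /= sqrrN addrC.
Qed.

Lemma cvg_complexP (T : Type) (F : set_system T) {FF : Filter F}
    (f : T -> R[i]) (l : R[i]) :
  f @ F --> l <->
  (complex.Re (f x) @[x --> F] --> complex.Re l) /\
  (complex.Im (f x) @[x --> F] --> complex.Im l).
Proof.
split=> [/cvgrPdist_lt fl|[/cvgrPdist_lt fRe /cvgrPdist_lt fIm]].
- split; apply/cvgrPdist_lt => e e0.
    apply: filterS (fl e%:C%C _) => [x lfx|]; last by rewrite ltcR.
    rewrite -ltcR; apply: le_lt_trans lfx.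
    by rewrite -raddfB; exact: normc_ge_Re.
  apply: filterS (fl e%:C%C _) => [x lfx|]; last by rewrite ltcR.
  rewrite -ltcR; apply: le_lt_trans lfx.
  by rewrite -raddfB; exact: normc_ge_Im.
- apply/cvgrPdist_lt => e; rewrite ltcE /= => /andP[/eqP ei e0].
  have e20 : 0 < complex.Re e / 2 by rewrite divr_gt0.
  have eE : e = (complex.Re e)%:C%C by rewrite [LHS]complexE ei mulr0 addr0.
  apply: filterS2 (fRe _ e20) (fIm _ e20) => x xRe xIm.
  rewrite eE; apply: le_lt_trans (normc_le_ReIm _) _.
  by rewrite ltcR [complex.Re e]splitr !raddfB ltrD.
Qed.

(** The neighbourhoods of a matrix are products of neighbourhoods of its
    finitely many entries. *)
Lemma cvg_mxP (T : Type) (F : set_system T) {FF : Filter F} (p q : nat)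
    (f : T -> 'M[R[i]]_(p, q)) (l : 'M[R[i]]_(p, q)) :
  f @ F --> l <-> forall i j, f x i j @[x --> F] --> l i j.
Proof.
split=> [fl i j A lA|fl A [P lP PA]].
  apply: (fl [set M | A (M i j)]).
  exists (fun i' j' => if (i' == i) && (j' == j) then A else setT).
    move=> i' j'; case: ifPn => [/andP[/eqP-> /eqP->]//|_]; exact: filterT.
  by move=> M /(_ i j); rewrite !eqxx.
suff : \forall x \near F, forall ij : 'I_p * 'I_q, P ij.1 ij.2 (f x ij.1 ij.2).
  by apply: filterS => x Px; apply: PA => i j; exact: (Px (i, j)).
by apply: filter_forall => -[i j]; exact: fl.
Qed.

Lemma cvg_mulmxl (T : Type) (F : set_system T) {FF : Filter F} (p q r : nat)
    (L : 'M[R[i]]_(p, q)) (f : T -> 'M[R[i]]_(q, r)) (l : 'M[R[i]]_(q, r)) :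
  f @ F --> l -> L *m f x @[x --> F] --> L *m l.
Proof.
move=> /cvg_mxP fl; apply/cvg_mxP => i j; rewrite mxE.
under eq_cvg do rewrite mxE.
by apply: (cvg_big add_continuous) => k _; apply: cvgMl_tmp; exact: fl.
Qed.

Lemma cvg_mulmxr (T : Type) (F : set_system T) {FF : Filter F} (p q r : nat)
    (N : 'M[R[i]]_(q, r)) (f : T -> 'M[R[i]]_(p, q)) (l : 'M[R[i]]_(p, q)) :
  f @ F --> l -> f x *m N @[x --> F] --> l *m N.
Proof.
move=> /cvg_mxP fl; apply/cvg_mxP => i j; rewrite mxE.
under eq_cvg do rewrite mxE.
by apply: (cvg_big add_continuous) => k _; apply: cvgMr_tmp; exact: fl.
Qed.

Lemma complex_conjE (z : R[i]) : z^* = (complex.Re z -i* complex.Im z)%C.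
Proof. by case: z. Qed.

Lemma cvg_adj (T : Type) (F : set_system T) {FF : Filter F} (p q : nat)
    (f : T -> 'M[R[i]]_(p, q)) (l : 'M[R[i]]_(p, q)) :
  f @ F --> l -> (f x)^t* @[x --> F] --> l^t*.
Proof.
move=> /cvg_mxP fl; apply/cvg_mxP => i j.
have /cvg_complexP[fr fi] := fl j i.
under eq_cvg do rewrite !mxE complex_conjE.
by rewrite !mxE complex_conjE; apply/cvg_complexP; split=> //=; exact: cvgN.
Qed.

End EntrywiseConvergence.

(** * Derivatives of matrix functions of a real variable *)

Section MatrixDerivative.
Variable R : realType.

Definition complex_derive (f : R -> R[i]) (x : R) (d : R[i]) : Prop :=
  is_derive x 1 (fun y => complex.Re (f y)) (complex.Re d) /\
  is_derive x 1 (fun y => complex.Im (f y)) (complex.Im d).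

(** A two-sided derivative at one point, read off on the real and imaginary
    parts of the entries: there the real calculus of derivatives, power series
    and integrals applies directly. *)
Definition mx_derive p q (F : R -> 'M[R[i]]_(p, q)) (x : R)
    (D : 'M[R[i]]_(p, q)) : Prop :=
  forall i j, complex_derive (fun y => F y i j) x (D i j).

Lemma complex_ReM (z w : R[i]) : complex.Re (z * w) =
  complex.Re z * complex.Re w - complex.Im z * complex.Im w.
Proof. by case: z w => [a b] [c d]. Qed.

Lemma complex_ImM (z w : R[i]) : complex.Im (z * w) =
  complex.Re z * complex.Im w + complex.Im z * complex.Re w.
Proof. by case: z w => [a b] [c d]. Qed.

Lemma complex_deriveM f g x df dg :
  complex_derive f x df -> complex_derive g x dg ->
  complex_derive (fun y => f y * g y) x (df * g x + f x * dg).
Proof.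
move=> [fr fi] [gr gi]; split.
  rewrite raddfD /= !complex_ReM.
  under [X in is_derive _ _ X]eq_fun do rewrite complex_ReM.
  apply: is_derive_eq; rewrite /GRing.scale /=; ring.
rewrite raddfD /= !complex_ImM.
under [X in is_derive _ _ X]eq_fun do rewrite complex_ImM.
apply: is_derive_eq; rewrite /GRing.scale /=; ring.
Qed.

Lemma complex_derive_sum (I : Type) (r : seq I) (f : I -> R -> R[i]) x d :
  (forall k, complex_derive (f k) x (d k)) ->
  complex_derive (fun y => \sum_(k <- r) f k y) x (\sum_(k <- r) d k).
Proof.
move=> fd; elim: r => [|k r [IHr IHi]].
  rewrite big_nil; under eq_fun do rewrite big_nil; split; exact: is_derive_cst.
rewrite big_cons; under eq_fun do rewrite big_cons.
have [kr ki] := fd k.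
by split; rewrite raddfD /=; under eq_fun do rewrite raddfD /=;
  exact: is_deriveD.
Qed.

Lemma mx_derive_cst p q (C : 'M[R[i]]_(p, q)) x : mx_derive (fun=> C) x 0.
Proof. by move=> i j; rewrite mxE; split; exact: is_derive_cst. Qed.

Lemma mx_deriveD p q (F G : R -> 'M[R[i]]_(p, q)) x DF DG :
  mx_derive F x DF -> mx_derive G x DG ->
  mx_derive (fun y => F y + G y) x (DF + DG).
Proof.
move=> FD GD i j; have [[Fr Fi] [Gr Gi]] := (FD i j, GD i j).
rewrite mxE; under eq_fun do rewrite mxE.
by split; rewrite raddfD /=; under eq_fun do rewrite raddfD /=;
  exact: is_deriveD.
Qed.

Lemma mx_deriveM p q r (F : R -> 'M[R[i]]_(p, q)) (G : R -> 'M[R[i]]_(q, r))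
    x DF DG :
  mx_derive F x DF -> mx_derive G x DG ->
  mx_derive (fun y => F y *m G y) x (DF *m G x + F x *m DG).
Proof.
move=> FD GD i j; rewrite !mxE -big_split /=.
under eq_fun do rewrite mxE.
by apply: complex_derive_sum => k; exact: complex_deriveM.
Qed.

Lemma mx_derive_mulmx p q r s (L : 'M[R[i]]_(p, q)) (F : R -> 'M[R[i]]_(q, r))
    (N : 'M[R[i]]_(r, s)) x D :
  mx_derive F x D -> mx_derive (fun y => L *m F y *m N) x (L *m D *m N).
Proof.
move=> FD.
have := mx_deriveM (mx_deriveM (mx_derive_cst L x) FD) (mx_derive_cst N x).
by rewrite mul0mx add0r mulmx0 addr0.
Qed.

Lemma mx_deriveZ p q (c : R[i]) (F : R -> 'M[R[i]]_(p, q)) x D :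
  mx_derive F x D -> mx_derive (fun y => c *: F y) x (c *: D).
Proof.
move=> FD; have := mx_deriveM (mx_derive_cst c%:M x) FD.
by under eq_fun do rewrite mul_scalar_mx; rewrite mul0mx add0r mul_scalar_mx.
Qed.

Lemma mx_derive_adj p q (F : R -> 'M[R[i]]_(p, q)) x D :
  mx_derive F x D -> mx_derive (fun y => (F y)^t*) x (D^t*).
Proof.
move=> FD i j; have [Fr Fi] := FD j i.
rewrite !mxE complex_conjE; under eq_fun do rewrite !mxE complex_conjE.
split=> //=; exact: is_deriveN.
Qed.

(** Translates the increment form of the derivative, with a step tending to
    0, into the difference quotient with a moving endpoint, the form that can be
    restricted to an interval. *)
Lemma is_derive_quotientP (g : R -> R) (x d : R) :
  is_derive x 1 g d <-> (y - x)^-1 * (g y - g x) @[y --> x^'] --> d.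
Proof.
have shiftP (f : R -> R) l : f y @[y --> x^'] --> l <->
    f (x + h) @[h --> 0^'] --> l.
  have nearP (A : set R) :
      (\forall y \near x^', A y) <-> (\forall h \near 0^', A (x + h)).
    have nearP := nbhs0P (fun y => y != x -> A y) x.
    split=> [/nearP xA|xA].
      apply: (@filterS _ (nbhs (0 : R))) xA => h xe.
      by move=> h0; apply: xe; rewrite /= -subr_eq0 addrC addKr.
    apply/nearP; apply: (@filterS _ (nbhs (0 : R))) xA => h xe.
    by move=> xh0; apply: xe; move: xh0; rewrite /= -subr_eq0 addrC addKr.
  by split=> fl A lA; apply/(nearP (f @^-1` A)); exact: fl.
have quotE : (fun h => h^-1 *: ((g \o shift x) (h *: 1) - g x)) =
    (fun h => (x + h - x)^-1 * (g (x + h) - g x)).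
  by apply/funext => h; rewrite /= [h *: 1]mulr1 [x + h]addrC addrK.
rewrite shiftP; split=> [[gx <-]|gx].
  by rewrite -quotE.
rewrite -quotE in gx; apply: DeriveDef; first by apply/cvg_ex; exists d.
exact: cvg_lim.
Qed.

Lemma mx_derive_in p q (I : interval R) (F : R -> 'M[R[i]]_(p, q)) x D :
  mx_derive F x D -> is_deriv_in I F x D.
Proof.
move=> FD; apply/cvg_mxP => i j; apply/cvg_complexP.
have [/is_derive_quotientP Fr /is_derive_quotientP Fi] := FD i j.
split; apply: cvg_within_filter.
  apply: cvg_trans Fr; apply: near_eq_cvg; apply: nearW => y.
  by rewrite !mxE complex_ReM /= mul0r subr0 raddfB.
apply: cvg_trans Fi; apply: near_eq_cvg; apply: nearW => y.
by rewrite !mxE complex_ImM /= mul0r addr0 raddfB.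
Qed.

Lemma mx_derive_eq p q (F : R -> 'M[R[i]]_(p, q)) x D D' :
  mx_derive F x D -> D = D' -> mx_derive F x D'.
Proof. by move=> ? <-. Qed.

End MatrixDerivative.

(** * The matrix exponential *)

Section ExponentialSeries.
Variable R : realType.

(** Such a sequence, divided by factorials, has a power series of infinite
    radius of convergence; unlike convergence itself, this growth condition is
    visibly stable under the shift by which differentiation acts. *)
Definition geom_bounded (u : nat -> R) : Prop :=
  exists C c, forall k, `|u k| <= C * c ^+ k.

Lemma geom_boundedS u : geom_bounded u -> geom_bounded (fun k => u k.+1).
Proof.
by move=> [C [c uC]]; exists (C * c), c => k; rewrite -mulrA -exprS.
Qed.

Lemma is_cvg_exp_pseries u x :
  geom_bounded u -> cvgn (pseries (fun k => u k / k`!%:R) x).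
Proof.
move=> [C [c uC]].
have C0 : 0 <= C.
  by rewrite -[C]mulr1; apply: le_trans (uC 0%N); rewrite normr_ge0.
have cvgC : cvgn (series (fun k => C * exp_coeff (`|c| * `|x|) k)).
  by apply: is_cvg_seriesZ; exact: is_cvg_series_exp_coeff.
apply: normed_cvg; apply: series_le_cvg cvgC => k //=.
  by rewrite mulr_ge0// exp_coeff_ge0// mulr_ge0.
rewrite !normrM normfV normr_nat normrX /exp_coeff /= exprMn.
rewrite -mulrA [_^-1 * _]mulrC !mulrA ler_wpM2r ?invr_ge0 ?ler0n//.
rewrite ler_wpM2r ?exprn_ge0//; apply: le_trans (uC k) _.
by rewrite ler_wpM2l// -normrX ler_norm.
Qed.

Lemma pseries_diffs_fact u : pseries_diffs (fun k => u k / k`!%:R : R) =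
  (fun k => u k.+1 / k`!%:R).
Proof.
apply/funext => k; rewrite /pseries_diffs factS natrM invfM.
by rewrite mulrCA mulVKf// pnatr_eq0.
Qed.

Lemma is_derive_exp_pseries u (x : R) : geom_bounded u ->
  is_derive x (1 : R) (fun y => limn (pseries (fun k => u k / k`!%:R) y))
    (limn (pseries (fun k => u k.+1 / k`!%:R) x)).
Proof.
move=> ub; rewrite -pseries_diffs_fact.
apply: (@pseries_snd_diffs _ _ (`|x| + 1)); rewrite ?pseries_diffs_fact.
- exact: is_cvg_exp_pseries.
- by apply: (is_cvg_exp_pseries (u := fun k => u k.+1)); exact: geom_boundedS.
- apply: (is_cvg_exp_pseries (u := fun k => u k.+2)).
  by apply: (geom_boundedS (u := fun k => u k.+1)); exact: geom_boundedS.
- by rewrite [ltRHS]ger0_norm ?addr_ge0// ltrDl.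
Qed.

End ExponentialSeries.

Section MatrixExponential.
Variables (R : realType) (n : nat).
Implicit Types M : 'M[R[i]]_n.

(** The sum of the moduli of all entries bounds every row sum, so each
    further factor M costs at most that constant in every entry. *)
Lemma norm_mx_exp M k i j :
  `|(M ^+ k) i j| <= (\sum_i \sum_j `|M i j|) ^+ k.
Proof.
elim: k i j => [|k IH] i j.
  by rewrite !expr0 mxE; case: (i == j); rewrite ?normr1 ?normr0.
rewrite !exprS mxE; apply: le_trans (ler_norm_sum _ _ _) _.
apply: (@le_trans _ _ (\sum_l `|M i l| * (\sum_i \sum_j `|M i j|) ^+ k)).
  by apply: ler_sum => l _; rewrite normrM ler_wpM2l.
rewrite -mulr_suml ler_wpM2r ?exprn_ge0 ?sumr_ge0// => [i' _|].
  by rewrite sumr_ge0.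
rewrite [leRHS](bigD1 i)//= lerDl sumr_ge0// => i' _.
by rewrite sumr_ge0.
Qed.

Lemma geom_bounded_mx_exp M i j :
  geom_bounded (fun k => complex.Re ((M ^+ k) i j)) /\
  geom_bounded (fun k => complex.Im ((M ^+ k) i j)).
Proof.
pose c : R[i] := \sum_i \sum_j `|M i j|.
have cE : c = (complex.Re c)%:C%C.
  rewrite RRe_real// ger0_real// sumr_ge0// => i' _; rewrite sumr_ge0//.
by split; exists 1, (complex.Re c) => k; rewrite mul1r -lecR rmorphXn /= -cE;
  [apply: le_trans (normc_ge_Re _) _|apply: le_trans (normc_ge_Im _) _];
  exact: norm_mx_exp.
Qed.

Let expx M k : 'M[R[i]]_n := (k`!%:R)^-1 *: M ^+ k.

(** The factor M ^+ r on the left turns the coefficients into their r-fold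
    shift: r = 0 gives the exponential itself, and r = 1 the series of its
    termwise derivative. *)
Lemma expxE M (x : R) r k i j :
  let u := (M ^+ (r + k)) i j in
  let v := (M ^+ r *m expx (x%:C%C *: M) k) i j in
  complex.Re v = complex.Re u / k`!%:R * x ^+ k /\
  complex.Im v = complex.Im u / k`!%:R * x ^+ k.
Proof.
rewrite /expx /=.
have -> : (x%:C%C *: M) ^+ k = (x ^+ k)%:C%C *: M ^+ k.
  elim: k => [|k IH]; first by rewrite !expr0 rmorph1 scale1r.
  by rewrite !exprS IH rmorphM /= -!mulmxE -scalemxAl -scalemxAr scalerA.
rewrite -!scalemxAr mulmxE -exprD 2!mxE; case: (_ i j) => a b.
have -> : (k`!%:R : R[i])^-1 = (k`!%:R^-1)%:C%C by rewrite fmorphV rmorph_nat.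
by rewrite !complex_ReM !complex_ImM /=; split; ring.
Qed.

Lemma cvg_expmx_pseries M (x : R) r i j :
  let v := fun k => (M ^+ r *m series (expx (x%:C%C *: M)) k) i j in
  complex.Re (v k) @[k --> \oo] -->
    limn (pseries (fun k => complex.Re ((M ^+ (r + k)) i j) / k`!%:R) x) /\
  complex.Im (v k) @[k --> \oo] -->
    limn (pseries (fun k => complex.Im ((M ^+ (r + k)) i j) / k`!%:R) x).
Proof.
have [br bi] := geom_bounded_mx_exp M i j.
have shiftb u : geom_bounded u -> geom_bounded (fun k => u (r + k)%N : R).
  by elim: r => // r IH /IH /geom_boundedS; under eq_fun do rewrite addnS.
split.
  rewrite (_ : (fun k => _) =
      pseries (fun k => complex.Re ((M ^+ (r + k)) i j) / k`!%:R) x).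
    exact: is_cvg_exp_pseries (shiftb _ br).
  apply/funext => k; rewrite /pseries /series /= mulmx_sumr summxE raddf_sum.
  by apply: eq_bigr => l _; case: (expxE M x r l i j).
rewrite (_ : (fun k => _) =
    pseries (fun k => complex.Im ((M ^+ (r + k)) i j) / k`!%:R) x).
  exact: is_cvg_exp_pseries (shiftb _ bi).
apply/funext => k; rewrite /pseries /series /= mulmx_sumr summxE raddf_sum.
by apply: eq_bigr => l _; case: (expxE M x r l i j).
Qed.

Lemma expmx_uniq M E : series (expx M) @ \oo --> E -> expmx M = E.
Proof. by move=> ME; apply: cvg_lim ME; exact: norm_hausdorff. Qed.

Lemma cvg_expmx M : series (expx M) @ \oo --> expmx M.
Proof.
suff [E ME] : exists E : 'M[R[i]]_n, series (expx M) @ \oo --> E.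
  by have -> := expmx_uniq ME; exact: ME.
have := cvg_expmx_pseries M 1 0; rewrite rmorph1 scale1r => M1.
exists (\matrix_(i, j) Complex
  (limn (pseries (fun k => complex.Re ((M ^+ k) i j) / k`!%:R) 1))
  (limn (pseries (fun k => complex.Im ((M ^+ k) i j) / k`!%:R) 1))).
apply/cvg_mxP => i j; rewrite mxE; apply/cvg_complexP.
have [] := M1 i j; rewrite expr0 => Re1 Im1; split.
  by under eq_cvg do rewrite -[series _ _]mul1mx; exact: Re1.
by under eq_cvg do rewrite -[series _ _]mul1mx; exact: Im1.
Qed.

Lemma expmx_pseries M (x : R) r i j :
  let e := (M ^+ r *m expmx (x%:C%C *: M)) i j in
  complex.Re e =
    limn (pseries (fun k => complex.Re ((M ^+ (r + k)) i j) / k`!%:R) x) /\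
  complex.Im e =
    limn (pseries (fun k => complex.Im ((M ^+ (r + k)) i j) / k`!%:R) x).
Proof.
have lim_e : M ^+ r *m series (expx (x%:C%C *: M)) k @[k --> \oo] -->
    M ^+ r *m expmx (x%:C%C *: M) by apply: cvg_mulmxl; exact: cvg_expmx.
move: lim_e => /cvg_mxP/(_ i j)/cvg_complexP[Re_e Im_e].
have [Re_l Im_l] := cvg_expmx_pseries M x r i j.
by split; [exact: (cvg_unique (@norm_hausdorff _ _) Re_e Re_l)|
  exact: (cvg_unique (@norm_hausdorff _ _) Im_e Im_l)].
Qed.

Lemma expmx_derive M (x : R) :
  mx_derive (fun y => expmx (y%:C%C *: M)) x (M *m expmx (x%:C%C *: M)).
Proof.
move=> i j.
have [br bi] := geom_bounded_mx_exp M i j.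
have [Re1 Im1] := expmx_pseries M x 1 i j; rewrite expr1 in Re1 Im1.
have e0 y := expmx_pseries M y 0 i j.
split; rewrite ?Re1 ?Im1.
  rewrite (_ : (fun y => _) = (fun y => limn (pseries
    (fun k => complex.Re ((M ^+ k) i j) / k`!%:R) y))).
    exact: is_derive_exp_pseries.
  by apply/funext => y; case: (e0 y) => + _; rewrite expr0 mulmxE mul1r.
rewrite (_ : (fun y => _) = (fun y => limn (pseries
  (fun k => complex.Im ((M ^+ k) i j) / k`!%:R) y))).
  exact: is_derive_exp_pseries.
by apply/funext => y; case: (e0 y) => _; rewrite expr0 mulmxE mul1r.
Qed.

End MatrixExponential.

Section ExponentialLaws.
Variable R : realType.

(** An intertwining relation passes to powers, partial sums and the limit.
    With a rectangular C it covers commutation, blocks of triangular matrices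
    and block-diagonal matrices at once. *)
Lemma expmx_intertwine p q (C : 'M[R[i]]_(p, q)) (M : 'M[R[i]]_q)
    (N : 'M[R[i]]_p) :
  C *m M = N *m C -> C *m expmx M = expmx N *m C.
Proof.
move=> CM.
have CMk k : C *m M ^+ k = N ^+ k *m C.
  elim: k => [|k IH]; first by rewrite !expr0 mulmx1 mul1mx.
  by rewrite !exprS -!mulmxE mulmxA CM -!mulmxA IH.
have /cvg_lim <- // :
    C *m series (fun k => (k`!%:R)^-1 *: M ^+ k) k @[k --> \oo] -->
      C *m expmx M by apply: cvg_mulmxl; exact: cvg_expmx.
apply: cvg_lim => //.
have : series (fun k => (k`!%:R)^-1 *: N ^+ k) k *m C @[k --> \oo]
    --> expmx N *m C by apply: cvg_mulmxr; exact: cvg_expmx.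
apply: cvg_trans; apply: near_eq_cvg; apply: nearW => k.
rewrite /series /= mulmx_sumr mulmx_suml; apply: eq_bigr => l _.
by rewrite -scalemxAl -scalemxAr CMk.
Qed.

Lemma expmx0 n : expmx (0 : 'M[R[i]]_n) = 1.
Proof.
apply: expmx_uniq; rewrite -cvg_shiftS.
rewrite (_ : (fun k => _) = cst 1); first exact: cvg_cst.
apply/funext => k; rewrite /series /= big_nat_recl//= invr1 scale1r expr0.
by rewrite big1 ?addr0// => l _; rewrite exprS mul0r scaler0.
Qed.

Lemma expmx_adj n (M : 'M[R[i]]_n) : (expmx M)^t* = expmx (M^t*).
Proof.
have adjX k : (M ^+ k)^t* = (M^t*) ^+ k.
  elim: k => [|k IH]; first by rewrite !expr0 trmx1 map_mx1.
  by rewrite exprS exprSr -!mulmxE trmx_mul map_mxM IH.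
symmetry; apply: expmx_uniq.
have : (series (fun k => (k`!%:R)^-1 *: M ^+ k) k)^t* @[k --> \oo]
    --> (expmx M)^t* by apply: cvg_adj; exact: cvg_expmx.
apply: cvg_trans; apply: near_eq_cvg; apply: nearW => k.
rewrite /series /= !raddf_sum; apply: eq_bigr => l _ /=.
by rewrite linearZ /= map_mxZ adjX fmorphV rmorph_nat.
Qed.

Lemma mx_derive_cst_eq p q (F : R -> 'M[R[i]]_(p, q)) x y :
  (forall z, mx_derive F z 0) -> F x = F y.
Proof.
move=> F0; apply/matrixP => i j; apply/eqP; rewrite eq_complex; apply/andP.
split; apply/eqP.
  apply: (is_derive_0_is_cst (f := fun z => complex.Re (F z i j))) => z.
  by have [+ _] := F0 z i j; rewrite mxE.
apply: (is_derive_0_is_cst (f := fun z => complex.Im (F z i j))) => z.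
by have [_ +] := F0 z i j; rewrite mxE.
Qed.

Lemma expmx_mulN n (M : 'M[R[i]]_n) : expmx M *m expmx (- M) = 1%:M.
Proof.
pose F (s : R) := expmx (s%:C%C *: M) *m expmx (s%:C%C *: - M).
have F0 s : mx_derive F s 0.
  apply: mx_derive_eq (mx_deriveM (expmx_derive M s) (expmx_derive (- M) s)) _.
  have eM : expmx (s%:C%C *: M) *m M = M *m expmx (s%:C%C *: M).
    by symmetry; apply: expmx_intertwine; rewrite -scalemxAr -scalemxAl.
  by rewrite mulNmx mulmxN [X in _ - X]mulmxA eM subrr.
have := mx_derive_cst_eq 1 0 F0.
by rewrite /F rmorph1 rmorph0 !scale1r !scale0r expmx0 mulmx1.
Qed.

(** The product of F with the exponential of the opposite matrix is constant,
    since the two derivatives cancel. *)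
Lemma linear_ode_sol n p (M : 'M[R[i]]_n) (F : R -> 'M[R[i]]_(n, p)) s :
  (forall z, mx_derive F z (M *m F z)) -> F s = expmx (s%:C%C *: M) *m F 0.
Proof.
move=> FM; pose G (z : R) := expmx (z%:C%C *: - M) *m F z.
have G0 z : mx_derive G z 0.
  apply: mx_derive_eq (mx_deriveM (expmx_derive (- M) z) (FM z)) _.
  have eM : expmx (z%:C%C *: - M) *m M = M *m expmx (z%:C%C *: - M).
    symmetry; apply: expmx_intertwine.
    by rewrite -scalemxAr -scalemxAl mulmxN mulNmx.
  by rewrite [X in _ + X]mulmxA eM !mulNmx addNr.
have := mx_derive_cst_eq s 0 G0.
rewrite /G rmorph0 scale0r expmx0 mul1mx => <-.
by rewrite mulmxA scalerN expmx_mulN mul1mx.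
Qed.

(** With M and N scaled by s, both sides solve the same linear differential
    equation in s with value 1 at s = 0. *)
Lemma expmxD n (M N : 'M[R[i]]_n) :
  M *m N = N *m M -> expmx (M + N) = expmx M *m expmx N.
Proof.
move=> MN; pose F (s : R) := expmx (s%:C%C *: M) *m expmx (s%:C%C *: N).
have FMN s : mx_derive F s ((M + N) *m F s).
  apply: mx_derive_eq (mx_deriveM (expmx_derive M s) (expmx_derive N s)) _.
  have eN : expmx (s%:C%C *: M) *m N = N *m expmx (s%:C%C *: M).
    by symmetry; apply: expmx_intertwine; rewrite -scalemxAr -scalemxAl MN.
  by rewrite mulmxDl /F [X in _ + X = _]mulmxA eN !mulmxA.
have F0 : F 0 = 1%:M by rewrite /F rmorph0 !scale0r expmx0 mulmx1.
have := linear_ode_sol 1 FMN; rewrite F0.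
rewrite [RHS]mulmx1 -[1%:C%C]/(1 : R[i]) scale1r => <-.
by rewrite /F -[1%:C%C]/(1 : R[i]) !scale1r.
Qed.

Lemma expmx_affine_derive n (M N : 'M[R[i]]_n) (x : R) :
  M *m N = N *m M ->
  mx_derive (fun y => expmx (y%:C%C *: M + N)) x
    (M *m expmx (x%:C%C *: M + N)).
Proof.
move=> MN.
have split_exp y : expmx (y%:C%C *: M + N) = expmx (y%:C%C *: M) *m expmx N.
  by apply: expmxD; rewrite -scalemxAr -scalemxAl MN.
rewrite split_exp; under eq_fun do rewrite split_exp.
have := mx_deriveM (expmx_derive M x) (mx_derive_cst (expmx N) x).
by rewrite [X in _ + X]mulmx0 addr0 mulmxA.
Qed.

End ExponentialLaws.

(** * Uniqueness of primitives and the fundamental theorem *)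

Section Calculus.
Variable R : realType.

Lemma is_derive_continuous (g : R -> R) (x d : R) : is_derive x 1 g d ->
  {for x, continuous g}.
Proof.
by move=> gd; apply: differentiable_continuous; apply/derivable1_diffP.
Qed.

(** The hypothesis is one-sided at the endpoints: it gives continuity on the
    closed segment and a vanishing derivative inside, which is what the mean
    value theorem requires. *)
Lemma quotient0_cst (g : R -> R) a b : a <= b ->
  (forall x, x \in `[a, b] ->
    (y - x)^-1 * (g y - g x) @[y --> within [set` `[a, b]] x^'] --> 0) ->
  g a = g b.
Proof.
move=> ab g0.
suff [c _] : exists2 c, c \in `[a, b] & g b - g a = 0 * (b - a).
  by rewrite mul0r => /eqP; rewrite subr_eq0 => /eqP.
apply: (MVT_segment (df := fun=> 0)) => // [x xab|].
  apply/is_derive_quotientP => A A0.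
  have gA : \forall y \near x, y != x -> y \in `[a, b] ->
      A ((y - x)^-1 * (g y - g x)).
    by apply: g0 => //; exact: subset_itv_oo_cc.
  apply: (@filterS2 _ (nbhs x)) gA (near_in_itvoo xab) => y gA yab yx.
  by apply: gA => //; exact: subset_itv_oo_cc.
apply/subspace_continuousP => x xab; apply/cvgrPdist_lt => e e0.
have gA : \forall y \near x, y != x -> y \in `[a, b] ->
    `|(y - x)^-1 * (g y - g x)| < 1.
  have /cvgr0Pnorm_lt := g0 x xab; exact.
have xe : \forall y \near x, `|x - y| < e by exact: (nbhsx_ballx x e e0).
apply: (@filterS2 _ (nbhs x)) gA xe => y gA xye yab.
have [->|yx] := eqVneq y x; first by rewrite subrr normr0.
have := gA yx yab; rewrite normrM normfV ltr_pdivrMl ?normr_gt0 ?subr_eq0//.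
by rewrite mulr1 distrC => /lt_trans; apply; rewrite distrC.
Qed.

Lemma is_deriv_inB p q (I : interval R) (F G : R -> 'M[R[i]]_(p, q)) x DF DG :
  is_deriv_in I F x DF -> is_deriv_in I G x DG ->
  is_deriv_in I (fun y => F y - G y) x (DF - DG).
Proof.
move=> FD GD; have FGD := cvgB FD GD; rewrite /is_deriv_in.
rewrite (_ : (fun y => _) = (fun y => ((y - x)^-1)%:C%C *: (F y - F x) -
    ((y - x)^-1)%:C%C *: (G y - G x))); first exact: FGD.
apply/funext => y; rewrite -scalerBr.
suff -> : F y - G y - (F x - G x) = (F y - F x) - (G y - G x) by [].
by rewrite [- (F x - G x)]opprD [- (G y - G x)]opprD addrACA.
Qed.

Lemma is_deriv_in0_cst p q (I : interval R) (F : R -> 'M[R[i]]_(p, q)) a b :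
  a \in I -> b \in I -> (forall x, x \in I -> is_deriv_in I F x 0) -> F a = F b.
Proof.
wlog ab : a b / a <= b => [hwlog aI bI F0|aI bI F0].
  by case/orP: (le_total a b) => ?; [|symmetry]; exact: hwlog.
have sub x : x \in `[a, b] -> x \in I.
  by apply: (@interval_is_interval _ I) => //.
apply/matrixP => i j; apply/eqP; rewrite eq_complex; apply/andP.
have entry x : x \in `[a, b] ->
    (((y - x)^-1)%:C%C *: (F y - F x)) i j
      @[y --> within [set` `[a, b]] x^'] --> (0 : R[i]).
  move=> /sub xI; have /cvg_mxP/(_ i j) := F0 x xI; rewrite mxE.
  by apply: cvg_trans; apply: cvg_app; apply: within_subset => y; exact: sub.
split; apply/eqP.
  apply: (quotient0_cst (g := fun y => complex.Re (F y i j))) => // x /entry.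
  move=> /cvg_complexP[+ _]; apply: cvg_trans; apply: near_eq_cvg.
  by apply: nearW => y; rewrite !mxE complex_ReM /= mul0r subr0 raddfB.
apply: (quotient0_cst (g := fun y => complex.Im (F y i j))) => // x /entry.
move=> /cvg_complexP[_ +]; apply: cvg_trans; apply: near_eq_cvg.
by apply: nearW => y; rewrite !mxE complex_ImM /= mul0r addr0 raddfB.
Qed.

Lemma oint_FTC (g d : R -> R) a b :
  (forall x : R, is_derive x 1 g (d x)) -> continuous d ->
  oint a b d = g b - g a.
Proof.
move=> gd dc.
have incr u v : u < v -> \int[lebesgue_measure]_(s in `[u, v]) d s = g v - g u.
  move=> uv; rewrite /Rintegral (continuous_FTC2 (F := g))//.
  - exact: continuous_subspaceT.
  - have gc x : {for x, continuous g} by exact: is_derive_continuous (gd x).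
    split=> [x _||]; first exact: ex_derive.
      exact/cvg_at_right_filter/gc.
    exact/cvg_at_left_filter/gc.
  - by move=> x _; rewrite derive1E derive_val.
rewrite /oint; case: ltgtP => [ab|ba|->].
- exact: incr.
- by rewrite incr// opprB.
- by rewrite set_itv1 Rintegral_set1 subrr.
Qed.

Lemma mx_oint_FTC p q (F D : R -> 'M[R[i]]_(p, q)) a b :
  (forall x, mx_derive F x (D x)) -> (forall x, exists D', mx_derive D x D') ->
  mx_oint a b D = F b - F a.
Proof.
move=> FD Dd; apply/matrixP => i j; rewrite !mxE.
have -> : oint a b (fun s => complex.Re (D s i j)) =
    complex.Re (F b i j) - complex.Re (F a i j).
  apply: (oint_FTC (g := fun x => complex.Re (F x i j))) => x.
    by case: (FD x i j).
  by have [D' /(_ i j)[/is_derive_continuous + _]] := Dd x.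
have -> : oint a b (fun s => complex.Im (D s i j)) =
    complex.Im (F b i j) - complex.Im (F a i j).
  apply: (oint_FTC (g := fun x => complex.Im (F x i j))) => x.
    by case: (FD x i j).
  by have [D' /(_ i j)[_ /is_derive_continuous]] := Dd x.
by case: (F b i j) (F a i j) => [? ?] [? ?].
Qed.

(** The interval may reduce to the single point a, where the derivatives
    carry no information and the claim is the initial condition. *)
Lemma is_deriv_in_eq p q (I : interval R) (F G D : R -> 'M[R[i]]_(p, q)) a :
  a \in I -> (forall x, x \in I -> is_deriv_in I F x (D x)) ->
  (forall x, x \in I -> is_deriv_in I G x (D x)) -> F a = G a ->
  forall x, x \in I -> F x = G x.
Proof.
move=> aI FD GD Fa x xI; apply/eqP; rewrite -subr_eq0; apply/eqP.
transitivity (F a - G a); last by rewrite Fa subrr.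
have D0 y : y \in I -> is_deriv_in I (fun y => F y - G y) y 0.
  move=> yI; rewrite -(subrr (D y)).
  exact: is_deriv_inB (FD y yI) (GD y yI).
exact: (is_deriv_in0_cst xI aI D0).
Qed.

End Calculus.

(** * The commuting flows *)

Section Flow.
Variable R : realType.

(** With K = i Q this is the exponential of i (x Q + 4 t Q^3), because
    (i Q)^3 = - i Q^3. The two generators K and -4 K^3 commute. *)
Definition flow n (K : 'M[R[i]]_n) (x t : R) : 'M[R[i]]_n :=
  expmx (x%:C%C *: K - (4 * t)%:C%C *: K ^+ 3).

Lemma flow00 n (K : 'M[R[i]]_n) : flow K 0 0 = 1%:M.
Proof. by rewrite /flow mulr0 rmorph0 !scale0r subr0 expmx0. Qed.

Lemma flow_intertwine p q (C : 'M[R[i]]_(p, q)) (M : 'M[R[i]]_q)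
    (N : 'M[R[i]]_p) x t :
  C *m M = N *m C -> C *m flow M x t = flow N x t *m C.
Proof.
move=> CM; apply: expmx_intertwine.
have CM3 : C *m M ^+ 3 = N ^+ 3 *m C.
  by rewrite !exprS !expr0 !mulr1 -!mulmxE !mulmxA CM -(mulmxA N) CM
             -!mulmxA CM.
by rewrite mulmxBr mulmxBl -!scalemxAr -!scalemxAl CM CM3.
Qed.

Lemma flow_adj n (K : 'M[R[i]]_n) x t : (flow K x t)^t* = flow (K^t*) x t.
Proof.
rewrite /flow expmx_adj; congr expmx.
have conj_real (a : R) : (a%:C%C)^* = a%:C%C by rewrite complex_conjE /= oppr0.
rewrite linearB /= map_mxB !linearZ /= !map_mxZ /= !conj_real.
by rewrite !exprS !expr0 !mulr1 -!mulmxE !trmx_mul !map_mxM !mulmxA scalerN.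
Qed.

Lemma flow_derive_x n (K : 'M[R[i]]_n) x t :
  mx_derive (fun y => flow K y t) x (K *m flow K x t).
Proof.
apply: expmx_affine_derive.
by rewrite mulmxN mulNmx -scalemxAr -scalemxAl mulmxE -exprS -exprSr.
Qed.

Lemma flow_derive_t n (K : 'M[R[i]]_n) x t :
  mx_derive (fun s => flow K x s) t (- (4 *: K ^+ 3) *m flow K x t).
Proof.
have flowE s : flow K x s = expmx (s%:C%C *: - (4 *: K ^+ 3) + x%:C%C *: K).
  rewrite /flow addrC [in RHS]scalerN [X in _ = expmx (- X + _)]scalerA.
  by rewrite [s%:C%C * 4]mulrC rmorphM /= rmorph_nat.
rewrite flowE; under eq_fun do rewrite flowE.
apply: expmx_affine_derive.
have KK3 : K ^+ 3 *m K = K *m K ^+ 3 by rewrite mulmxE -exprS -exprSr.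
move: (K ^+ 3) KK3 => L LK.
by rewrite mulNmx mulmxN -!scalemxAr -!scalemxAl LK !scalerA mulrC.
Qed.

End Flow.

Lemma adj_mulmx (C : numClosedFieldType) p q r (M : 'M[C]_(p, q))
  (N : 'M[C]_(q, r)) : (M *m N)^t* = N^t* *m M^t*.
Proof. by rewrite trmx_mul map_mxM. Qed.

Lemma adj_oppmx (C : numClosedFieldType) p q (M : 'M[C]_(p, q)) :
  (- M)^t* = - M^t*.
Proof. by apply/matrixP => i j; rewrite !mxE rmorphN. Qed.

(** * A closed form for the double primitive *)

Section Potential.
Variables (R : realType) (m : nat) (B Z : 'M[R[i]]_m).

Let E := flow B.
Let W : 'M[R[i]]_(m + m) := block_mx (- B) Z 0 (B^t*).
Let top : 'M[R[i]]_(m, m + m) := row_mx 1%:M 0.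
Let bot : 'M[R[i]]_(m, m + m) := row_mx 0 1%:M.

(** A common primitive, vanishing at the origin, of E Z E* in x and of
    -4 E (B^2 Z - B Z B* + Z B*^2) E* in t, where E = flow B. Its second factor
    is the upper right block of the flow of the triangular matrix W with
    diagonal blocks -B and B*; multiplying by E undoes the left diagonal block.
    No integral is taken, and the compatibility of the two equations is built
    in, as the upper right block of W^3 is B^2 Z - B Z B* + Z B*^2. *)
Definition potential (x t : R) : 'M[R[i]]_m :=
  E x t *m (top *m flow W x t *m bot^T).

Lemma potential00 : potential 0 0 = 0.
Proof.
rewrite /potential /E !flow00 mul1mx mulmx1 /top /bot tr_row_mx.
by rewrite mul_row_col trmx0 mulmx0 mul0mx addr0.
Qed.

Let bot_flow x t : bot *m flow W x t *m bot^T = (E x t)^t*.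
Proof.
rewrite (@flow_intertwine _ _ _ bot W (B^t*)); last first.
  by rewrite mul_row_block mul_mx_row !mul0mx !mul1mx !mulmx0 !mulmx1 !add0r.
by rewrite -mulmxA tr_row_mx mul_row_col trmx1 mulmx1 mul0mx add0r mulmx1
           flow_adj.
Qed.

Let topW : top *m W = - B *m top + Z *m bot.
Proof.
rewrite mul_row_block !mul_mx_row !mul0mx !mul1mx !mulmx0 !mulmx1 !addr0.
by rewrite add_row_mx addr0 add0r.
Qed.

Let botW : bot *m W = B^t* *m bot.
Proof.
by rewrite mul_row_block mul_mx_row !mul0mx !mul1mx !mulmx0 !mulmx1 !add0r.
Qed.

(** V stands for a generator of the flow of W, which is W itself in the
    variable x and a multiple of W ^+ 3 in the variable t. *)
Let top_step V a b x t : top *m V = a *m top + b *m bot ->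
  top *m (V *m flow W x t) *m bot^T =
  a *m (top *m flow W x t *m bot^T) + b *m (E x t)^t*.
Proof. by move=> tV; rewrite mulmxA tV !mulmxDl -bot_flow !mulmxA. Qed.

Let EB x t : E x t *m B = B *m E x t.
Proof. by symmetry; apply: flow_intertwine. Qed.

Lemma potential_derive_x x t :
  mx_derive (fun y => potential y t) x (E x t *m Z *m (E x t)^t*).
Proof.
apply: mx_derive_eq.
  by apply: mx_deriveM; [|apply: mx_derive_mulmx]; exact: flow_derive_x.
rewrite (top_step _ _ topW) mulmxDr [E x t *m (_ *m (_ *m _ *m _))]mulmxA.
by rewrite mulmxN EB mulNmx addNKr mulmxA.
Qed.

(** Lets the powers of W be computed on their first block row alone. *)
Let topMW U c d : top *m U = c *m top + d *m bot ->
  top *m (U *m W) = - (c *m B) *m top + (c *m Z + d *m B^t*) *m bot.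
Proof.
move=> tU; rewrite mulmxA tU mulmxDl -!mulmxA topW botW.
by rewrite mulmxDr mulmxDl !mulmxA mulmxN !mulNmx addrA.
Qed.

Let topW3 : top *m W ^+ 3 = - (B *m B *m B) *m top +
  (B *m B *m Z + (- (B *m Z) + Z *m B^t*) *m B^t*) *m bot.
Proof.
rewrite !exprSr expr0 mul1r -!mulmxE (topMW (topMW topW)).
by rewrite !mulNmx !opprK.
Qed.

Lemma potential_derive_t x t :
  mx_derive (fun s => potential x s) t
    (- (4 *: (E x t *m (B *m B *m Z + (- (B *m Z) + Z *m B^t*) *m B^t*)
              *m (E x t)^t*))).
Proof.
apply: mx_derive_eq.
  by apply: mx_deriveM; [|apply: mx_derive_mulmx]; exact: flow_derive_t.
have top4 : top *m - (4 *: W ^+ 3) = (4 *: (B *m B *m B)) *m top +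
    (- (4 *: (B *m B *m Z + (- (B *m Z) + Z *m B^t*) *m B^t*))) *m bot.
  rewrite mulmxN -scalemxAr topW3 scalerDr opprD mulNmx scalerN opprK.
  by rewrite -scalemxAl mulNmx -scalemxAl.
have E3 : E x t *m (B *m B *m B) = B *m B *m B *m E x t.
  rewrite !mulmxA EB -[B *m E x t *m B]mulmxA EB !mulmxA.
  by rewrite -[B *m B *m E x t *m B]mulmxA EB !mulmxA.
have B3 : B ^+ 3 = B *m B *m B by rewrite !exprSr expr0 mul1r -!mulmxE.
have E43 : E x t *m (4 *: (B *m B *m B)) = 4 *: (B *m B *m B) *m E x t.
  by rewrite -scalemxAr E3 -[RHS]scalemxAl.
rewrite (top_step _ _ top4) mulmxDr B3 -/E [X in _ + (X + _)]mulmxA E43.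
rewrite 2!mulNmx addKr mulNmx mulmxN -scalemxAl -scalemxAr.
by rewrite mulmxA.
Qed.

End Potential.

(** * The linear system and its Gram primitive *)

Section LinearPair.
Variables (R : realType) (n m h : nat).
Variables (A : 'M[R[i]]_n) (B : 'M[R[i]]_m).
Variables (P : 'M[R[i]]_(n, m)) (Y : 'M[R[i]]_(m, h)).
Hypothesis AP : A *m P = - (P *m B *m B).

Definition pair1 (x t : R) : 'M[R[i]]_(n, h) := - (P *m B) *m flow B x t *m Y.
Definition pair2 (x t : R) : 'M[R[i]]_(n, h) := P *m flow B x t *m Y.

Let B3 : B ^+ 3 = B *m B *m B.
Proof. by rewrite !exprSr expr0 mul1r -!mulmxE. Qed.

Lemma pair2_derive_x x t : mx_derive (fun y => pair2 y t) x (- pair1 x t).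
Proof.
apply: mx_derive_eq; first by apply: mx_derive_mulmx; exact: flow_derive_x.
by rewrite /pair1 !mulNmx opprK mulmxA.
Qed.

(** The second factor B, next to P, turns into A since A P = - P B^2. *)
Lemma pair1_derive_x x t : mx_derive (fun y => pair1 y t) x (A *m pair2 x t).
Proof.
apply: mx_derive_eq; first by apply: mx_derive_mulmx; exact: flow_derive_x.
by rewrite /pair2 !mulmxA AP !mulNmx.
Qed.

Lemma pair2_derive_t x t :
  mx_derive (fun s => pair2 x s) t (- (4 *: (A *m pair1 x t))).
Proof.
apply: mx_derive_eq; first by apply: mx_derive_mulmx; exact: flow_derive_t.
rewrite /pair1 B3; move: (flow B x t) => E.
rewrite !mulNmx !mulmxN !mulmxA AP !mulNmx opprK.
by rewrite -scalemxAr -!scalemxAl !mulmxA.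
Qed.

Lemma pair1_derive_t x t :
  mx_derive (fun s => pair1 x s) t (4 *: (A ^+ 2 *m pair2 x t)).
Proof.
apply: mx_derive_eq; first by apply: mx_derive_mulmx; exact: flow_derive_t.
rewrite /pair2 B3 expr2 -mulmxE; move: (flow B x t) => E.
rewrite !mulNmx mulmxN mulNmx opprK -!scalemxAl -!scalemxAr -!scalemxAl.
congr (_ *: _).
by rewrite !mulmxA -[A *m A *m P]mulmxA AP mulmxN !mulmxA AP !mulNmx opprK.
Qed.

(** Compressing the potential of Z = Y Y* by P turns E Z E* into the Gram
    matrix of P E Y, that is of pair2. *)
Definition pair_gram S0 (x t : R) : 'M[R[i]]_n :=
  S0 + P *m potential B (Y *m Y^t*) x t *m P^t*.

Lemma pair_gram00 S0 : pair_gram S0 0 0 = S0.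
Proof. by rewrite /pair_gram potential00 mulmx0 mul0mx addr0. Qed.

Lemma pair_gram_derive_x S0 x t :
  mx_derive (fun y => pair_gram S0 y t) x (pair2 x t *m (pair2 x t)^t*).
Proof.
apply: mx_derive_eq.
  apply: mx_deriveD; first exact: mx_derive_cst.
  by apply: mx_derive_mulmx; exact: potential_derive_x.
by rewrite add0r /pair2 !adj_mulmx !mulmxA.
Qed.

Lemma pair_gram_derive_t S0 x t :
  mx_derive (fun s => pair_gram S0 x s) t
    (4 *: (A *m pair2 x t *m (pair2 x t)^t*
           + pair2 x t *m (pair2 x t)^t* *m A^t*
           + pair1 x t *m (pair1 x t)^t*)).
Proof.
apply: mx_derive_eq.
  apply: mx_deriveD; first exact: mx_derive_cst.
  by apply: mx_derive_mulmx; exact: potential_derive_t.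
have EB : flow B x t *m B = B *m flow B x t.
  by symmetry; exact: flow_intertwine.
have PA : P^t* *m A^t* = - (B^t* *m B^t* *m P^t*).
  by rewrite -adj_mulmx AP adj_oppmx !adj_mulmx mulmxA.
have EBa : B^t* *m (flow B x t)^t* = (flow B x t)^t* *m B^t*.
  by rewrite -!adj_mulmx EB.
rewrite add0r /pair1 /pair2 !mulNmx adj_oppmx !adj_mulmx !mulmxN !mulNmx !opprK.
move: (flow B x t) ((flow B x t)^t*) EB EBa => E Ea EB EBa.
rewrite -scalemxAr -scalemxAl -scalerN; congr (_ *: _).
have PBE : P *m B *m E = P *m E *m B by rewrite -mulmxA -EB mulmxA.
have EaBP : Ea *m (B^t* *m P^t*) = B^t* *m (Ea *m P^t*).
  by rewrite mulmxA -EBa mulmxA.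
have -> : A *m (P *m E *m Y) = - (P *m E *m B *m B *m Y).
  by rewrite !mulmxA AP !mulNmx -[P *m B *m B *m E]mulmxA -EB mulmxA PBE.
rewrite -[P *m E *m Y *m _ *m A^t*]mulmxA.
have -> : Y^t* *m (Ea *m P^t*) *m A^t* =
    - (Y^t* *m (B^t* *m (B^t* *m (Ea *m P^t*)))).
  rewrite -!mulmxA PA !mulmxN -[B^t* *m B^t* *m P^t*]mulmxA.
  by rewrite [Ea *m (B^t* *m _)]mulmxA -EBa -[B^t* *m Ea *m _]mulmxA EaBP.
rewrite PBE EaBP 3!(mulmxDl, mulmxDr, mulNmx, mulmxN).
rewrite !(mulmxDl, mulmxDr, mulNmx, mulmxN) !mulmxA !opprD opprK.
by rewrite addrA addrAC.
Qed.

End LinearPair.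

(** * The two exponentials as one block flow *)

Section ExponentialPair.
Variables (R : realType) (n h : nat) (Q : 'M[R[i]]_n) (f1 f2 : 'M[R[i]]_(n, h)).

Let K : 'M[R[i]]_n := 'i%C *: Q.
Definition phase_gen : 'M[R[i]]_(n + n) := block_mx K 0 0 (- K).
Definition phase_row : 'M[R[i]]_(n, n + n) := row_mx 1%:M 1%:M.
Definition phase_init : 'M[R[i]]_(n + n, h) := col_mx f1 f2.

Let K2 : K *m K = - (Q ^+ 2).
Proof.
by rewrite -scalemxAl -scalemxAr scalerA -expr2 sqr_i scaleN1r mulmxE.
Qed.

Let K3 : K ^+ 3 = - ('i%C *: Q ^+ 3).
Proof.
by rewrite [K ^+ 3]exprS expr2 -!mulmxE K2 mulmxN -scalemxAl mulmxE -exprS.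
Qed.

Lemma phase_row_sqr :
  Q ^+ 2 *m phase_row = - (phase_row *m phase_gen *m phase_gen).
Proof.
rewrite /phase_row /phase_gen !mul_row_block !mulmx0 !addr0 !add0r !mul1mx.
by rewrite mulmxN mulNmx opprK K2 mul_mx_row mulmx1 opp_row_mx opprK.
Qed.

Lemma expmx_phase x t : expmx (phase Q x t) = flow K x t.
Proof.
rewrite /flow; congr expmx; rewrite K3 /phase /K; move: (Q ^+ 3) => Q3.
by rewrite scalerDr scalerN opprK !scalerA ['i%C * x%:C%C]mulrC
           ['i%C * (4 * t)%:C%C]mulrC.
Qed.

Lemma expmx_phaseN x t : expmx (- phase Q x t) = flow (- K) x t.
Proof.
rewrite /flow; congr expmx.
have -> : (- K) ^+ 3 = - K ^+ 3 by rewrite exprNn -signr_odd /= mulN1r.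
rewrite K3 /phase /K; move: (Q ^+ 3) => Q3.
by rewrite opprK scalerDr opprD !scalerN !scalerA ['i%C * x%:C%C]mulrC
           ['i%C * (4 * t)%:C%C]mulrC.
Qed.

(** Each coordinate block is invariant under the block-diagonal generator,
    so the flow of that generator acts on it as the flow of the block. *)
Let flow_phase_gen (a b : 'M[R[i]]_n) x t :
  row_mx a b *m flow phase_gen x t *m phase_init =
  a *m (flow K x t *m f1) + b *m (flow (- K) x t *m f2).
Proof.
have flowl : flow phase_gen x t *m col_mx 1%:M 0 = col_mx 1%:M 0 *m flow K x t.
  symmetry; apply: flow_intertwine.
  by rewrite mul_col_mx mul_block_col !mul0mx !mul1mx !mulmx0 !mulmx1 !addr0.
have flowr : flow phase_gen x t *m col_mx 0 1%:M =
    col_mx 0 1%:M *m flow (- K) x t.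
  symmetry; apply: flow_intertwine.
  by rewrite mul_col_mx mul_block_col !mul0mx !mul1mx !mulmx0 !mulmx1 !add0r.
have -> : phase_init = col_mx 1%:M 0 *m f1 + col_mx 0 1%:M *m f2.
  by rewrite !mul_col_mx !mul1mx !mul0mx add_col_mx addr0 add0r.
rewrite mulmxDr !mulmxA -!(mulmxA (row_mx a b)) flowl flowr !mulmxA.
by rewrite !mul_row_col !mulmx1 !mulmx0 addr0 add0r.
Qed.

Lemma Lambda2E x t : Lambda2 Q f1 f2 x t =
  pair2 phase_gen phase_row phase_init x t.
Proof.
by rewrite /Lambda2 expmx_phase expmx_phaseN /pair2 flow_phase_gen !mul1mx.
Qed.

Lemma Lambda1E x t : Lambda1 Q f1 f2 x t =
  pair1 phase_gen phase_row phase_init x t.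
Proof.
rewrite /Lambda1 expmx_phase expmx_phaseN /pair1.
have -> : - (phase_row *m phase_gen) = row_mx (- K) K.
  by rewrite mul_row_block !mulmx0 addr0 add0r !mul1mx opp_row_mx opprK.
by rewrite flow_phase_gen scaleNr mulmxBr !mulNmx opprK.
Qed.

End ExponentialPair.

(** * The exponential solutions *)

Theorem lemma2p6 (R : realType) (n h : nat) (I1 I2 : interval R)
    (A S0 Q : 'M[R[i]]_n) (theta1 theta2 f1 f2 : 'M[R[i]]_(n, h)) :
  (0 < n)%N -> (0 < h)%N -> 0 \in I1 -> 0 \in I2 ->
  is_triple A S0 (row_mx theta1 theta2) ->
  Q ^+ 2 = A ->
  let L1 := Lambda1 Q f1 f2 in
  let L2 := Lambda2 Q f1 f2 in
  [/\ forall x t, x \in I1 -> t \in I2 ->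
        [/\ is_deriv_in I1 (fun y => L1 y t) x (A *m L2 x t),
            is_deriv_in I1 (fun y => L2 y t) x (- L1 x t),
            is_deriv_in I2 (fun s => L1 x s) t (4 *: (A ^+ 2 *m L2 x t)) &
            is_deriv_in I2 (fun s => L2 x s) t (- (4 *: (A *m L1 x t)))],
      (- 'i%C *: Q) *m (f1 - f2) = theta1 -> f1 + f2 = theta2 ->
        row_mx (L1 0 0) (L2 0 0) = row_mx theta1 theta2 &
      exists S : R -> R -> 'M[R[i]]_n,
        [/\ solves_S Q f1 f2 I1 I2 A S0 S,
            forall S' : R -> R -> 'M[R[i]]_n, solves_S Q f1 f2 I1 I2 A S0 S' ->
              forall x t, x \in I1 -> t \in I2 -> S' x t = S x t &
            forall x t, x \in I1 -> t \in I2 ->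
              S x t = S0 + mx_oint 0 x (fun y => rhs_Sx Q f1 f2 y 0)
                         + mx_oint 0 t (fun s => rhs_St Q f1 f2 A x s)]].
Proof.
move=> _ _ I10 I20 _ QA L1 L2.
pose B := phase_gen Q; pose P : 'M[R[i]]_(n, n + n) := phase_row R n.
pose Y := phase_init f1 f2.
have AP : A *m P = - (P *m B *m B) by rewrite -QA; exact: phase_row_sqr.
have L1E x t : L1 x t = pair1 B P Y x t by exact: Lambda1E.
have L2E x t : L2 x t = pair2 B P Y x t by exact: Lambda2E.
have L1x x t : mx_derive (fun y => L1 y t) x (A *m L2 x t).
  rewrite L2E; under eq_fun do rewrite L1E; exact: pair1_derive_x.
have L2x x t : mx_derive (fun y => L2 y t) x (- L1 x t).
  rewrite L1E; under eq_fun do rewrite L2E; exact: pair2_derive_x.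
have L1t x t : mx_derive (fun s => L1 x s) t (4 *: (A ^+ 2 *m L2 x t)).
  rewrite L2E; under eq_fun do rewrite L1E; exact: pair1_derive_t.
have L2t x t : mx_derive (fun s => L2 x s) t (- (4 *: (A *m L1 x t))).
  rewrite L1E; under eq_fun do rewrite L2E; exact: pair2_derive_t.
pose S := pair_gram B P Y S0.
have Sx x t : mx_derive (fun y => S y t) x (rhs_Sx Q f1 f2 x t).
  by rewrite /rhs_Sx Lambda2E; exact: pair_gram_derive_x.
have St x t : mx_derive (fun s => S x s) t (rhs_St Q f1 f2 A x t).
  by rewrite /rhs_St Lambda2E Lambda1E; exact: pair_gram_derive_t.
split.
- by move=> x t _ _; split; apply: mx_derive_in.
- move=> <- <-; rewrite /L1 /L2 /Lambda1 /Lambda2.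
  have -> : phase Q 0 0 = 0.
    by rewrite /phase mulr0 rmorph0 !scale0r addr0 scaler0.
  by rewrite oppr0 expmx0 !mul1mx.
exists S; split.
- split=> [|x t _ _]; first exact: pair_gram00.
  by split; apply: mx_derive_in.
- move=> S' [S'0 S'd] x t xI tI.
  apply: (is_deriv_in_eq (F := S' x) (D := rhs_St Q f1 f2 A x) I20) => //.
  + by move=> s sI; have [_ S't] := S'd x s xI sI; exact: S't.
  + by move=> s _; exact: mx_derive_in (St x s).
  apply: (is_deriv_in_eq (F := S' ^~ 0) (G := S ^~ 0)
                         (D := fun y => rhs_Sx Q f1 f2 y 0) I10) => //.
  + by move=> y yI; have [S'x _] := S'd y 0 yI I20; exact: S'x.
  + by move=> y _; exact: mx_derive_in (Sx y 0).
  by rewrite S'0 /S pair_gram00.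
move=> x t _ _.
rewrite (mx_oint_FTC (F := S ^~ 0))//; last first.
  move=> y; eexists; apply: mx_deriveM; first exact: L2x.
  by apply: mx_derive_adj; exact: L2x.
rewrite (mx_oint_FTC (F := S x))//; last first.
  move=> s; eexists; apply: mx_deriveZ.
  have L2a := mx_derive_adj (L2t x s); have L1a := mx_derive_adj (L1t x s).
  apply: mx_deriveD; last exact: mx_deriveM (L1t x s) L1a.
  apply: mx_deriveD.
    exact: mx_deriveM (mx_deriveM (mx_derive_cst A s) (L2t x s)) L2a.
  exact: mx_deriveM (mx_deriveM (L2t x s) L2a) (mx_derive_cst (A^t*) s).
have S00 : S 0 0 = S0 by exact: pair_gram00.
by rewrite S00 addrC -addrA [S0 + _]addrC addrA subrK subrK.
Qed.
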